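(* Let $n\ge2$ and let $Q_0'$ be the linear operator from $\mathbb{C}[x_1,\ldots,x_{n-1}]^{S_{n-1}}$ to $\mathbb{C}[x_1,\ldots,x_n]^{S_n}$ defined by $$(Q_0'f)(x_1,\ldots,x_n)=\frac1n\sum_{j=1}^n f(x_1,\ldots,\hat x_j,\ldots,x_n),$$ where the hat marks the omitted argument. Then for every partition $(\lambda_1,\ldots,\lambda_{n-1})$ of length $n-1$, $$Q_0':\ \bar m_{(\lambda_1,\ldots,\lambda_{n-1})}(x_1,\ldots,x_{n-1})\mapsto\bar m_{(\lambda_1,\ldots,\lambda_{n-1},0)}(x_1,\ldots,x_n).$$
   Context: Partitions of length $N$ are $\lambda=(\lambda_1,\ldots,\lambda_N)\in\mathbb{N}^N$ with $\lambda_1\ge\cdots\ge\lambda_N\ge0$. For such $\lambda$ the monomial symmetric function $m_\lambda(x_1,\ldots,x_N)$ is the sum of $x_1^{\nu_1}\cdots x_N^{\nu_N}$ over all distinct permutations $\nu$ of $\lambda$, and $\bar m_\lambda(x)=m_\lambda(x)/m_\lambda(1,\ldots,1)$ is its normalized version. *)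

(* Defs.v *)
From HB Require Import structures.
From mathcomp Require Import all_boot all_order all_algebra all_fingroup.
From mathcomp Require Import mpoly.

Set Implicit Arguments.
Unset Strict Implicit.
Unset Printing Implicit Defensive.

Import GRing.Theory.

Local Open Scope ring_scope.

(* The K-vector space K[x_1, ..., x_n]^{S_n}. *)
Record sympoly (K : fieldType) (n : nat) := Sympoly {
  sympoly_val :> {mpoly K[n]};
  sympolyP : sympoly_val \is symmetric
}.

HB.instance Definition _ K n := [isSub for @sympoly_val K n].
HB.instance Definition _ K n := [Choice of sympoly K n by <:].
HB.instance Definition _ K n :=
  [SubChoice_isSubLmodule of sympoly K n by <:].

Section MonomialSymmetric.
Variables (K : fieldType) (n : nat).
Implicit Types lam : n.-tuple nat.

(* [permutations lam] is duplicate-free, so each distinct rearrangement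
   contributes exactly one monomial. *)
Definition monsym_mpoly lam : {mpoly K[n]} :=
  \sum_(nu <- permutations lam) 'X_[[multinom nth 0%N nu i | i < n]].

Lemma mcoeff_monsym lam (m : 'X_{1..n}) :
  (monsym_mpoly lam)@_m = (perm_eq m lam)%:R.
Proof.
rewrite /monsym_mpoly raddf_sum /= -mem_permutations.
have E nu : nu \in permutations lam ->
    ([multinom nth 0%N nu i | i < n] == m) = (nu == m :> seq nat).
  rewrite mem_permutations => /perm_size; rewrite size_tuple => sz.
  apply/eqP/eqP => [<-|->].
    apply: (@eq_from_nth _ 0%N); first by rewrite size_tuple.
    move=> i; rewrite sz => lti.
    by rewrite -[i]/(nat_of_ord (Ordinal lti)) -tnth_nth tnth_mktuple.
  by apply/mnmP=> i; rewrite mnmE mnm_tnth (tnth_nth 0%N).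
under eq_big_seq => nu nuP do rewrite mcoeffX (E nu nuP).
rewrite -natr_sum; congr (_%:R).
by rewrite -(count_uniq_mem _ (permutations_uniq _)) -sumn_count sumnE big_map.
Qed.

Lemma monsym_sym lam : monsym_mpoly lam \is symmetric.
Proof.
apply/issymP=> s; apply/mpolyP=> m; rewrite mcoeff_sym !mcoeff_monsym.
have /permPl -> // : perm_eq [multinom m (s i) | i < n] m.
by apply/tuple_permP; exists s; congr val.
Qed.

Definition monsym lam : sympoly K n := Sympoly (monsym_sym lam).

Definition nmonsym lam : sympoly K n :=
  ((monsym lam).@[fun=> 1])^-1 *: monsym lam.

End MonomialSymmetric.

Section Q0.
Variables (K : fieldType) (n : nat).

(* [lift j] is the increasing enumeration of 'I_n.+1 minus j, so the j-th
   summand is f(x_0, ..., x_(j-1), x_(j+1), ..., x_n). *)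
Definition Q0_mpoly (f : {mpoly K[n]}) : {mpoly K[n.+1]} :=
  n.+1%:R^-1 *: \sum_(j < n.+1) (f \mPo [tuple 'X_(lift j i) | i < n]).

Lemma Q0_sym (f : sympoly K n) : Q0_mpoly f \is symmetric.
Proof.
apply/issymP=> s; rewrite /Q0_mpoly linearZ /=; congr (_ *: _).
rewrite raddf_sum [RHS](reindex_inj (@perm_inj _ s)) /=.
apply: eq_bigr => j _.
have ne i : s j != s (lift j i) by rewrite (inj_eq perm_inj) neq_lift.
pose g i := odflt i (unlift (s j) (s (lift j i))).
have gE i : lift (s j) (g i) = s (lift j i).
  by rewrite /g; case: (unlift_some (ne i)) => k -> ->.
have g_inj : injective g.
  move=> i1 i2 /(congr1 (lift (s j))); rewrite !gE => /perm_inj.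
  exact: lift_inj.
rewrite -[in RHS](issymP _ (sympolyP f) (perm g_inj)) msym_mPo.
rewrite !comp_mpolyE raddf_sum; apply: eq_bigr => m _ /=.
rewrite linearZ /= rmorph_prod; congr (_ *: _); apply: eq_bigr => i _ /=.
rewrite rmorphXn !tnth_mktuple permE gE /= msymX; congr ('X_[_] ^+ _).
by apply/mnmP=> k; rewrite !mnmE -(inj_eq (@perm_inj _ s)) permKV.
Qed.

Definition Q0' (f : sympoly K n) : sympoly K n.+1 := Sympoly (Q0_sym f).

Lemma Q0'_is_linear : linear Q0'.
Proof.
move=> a f g; apply: val_inj.
change (Q0_mpoly (a *: (f : {mpoly K[n]}) + g) = a *: Q0_mpoly f + Q0_mpoly g).
rewrite /Q0_mpoly scalerA mulrC -scalerA -scalerDr; congr (_ *: _).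
rewrite scaler_sumr -big_split; apply: eq_bigr => j _ /=.
by rewrite linearP.
Qed.

HB.instance Definition _ :=
  GRing.isLinear.Build K (sympoly K n) (sympoly K n.+1) *:%R Q0' Q0'_is_linear.

End Q0.

(* Main.v *)
(** Comparing coefficients, [Q0'] sends [m_lam] to [a m_(lam,0)], where [a] is
    the proportion of zeros in [(lam, 0)].  As [Q0'] preserves the value at
    [(1, ..., 1)], the normalizing constants differ by the same factor
    [a <> 0], so they need not be computed. *)

Require Import Defs.
From mathcomp Require Import all_boot all_order all_algebra.
From mathcomp Require Import reals complex mpoly.

Local Open Scope ring_scope.

Import GRing.Theory Num.Theory.

Definition mnm_del n (j : 'I_n.+1) (m : 'X_{1..n.+1}) : 'X_{1..n} :=
  [multinom m (lift j i) | i < n].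

(** Exponent of the image of ['X_[m]] when its variables are renamed along [lift j]. *)
Definition mnm_ins0 n (j : 'I_n.+1) (m : 'X_{1..n}) : 'X_{1..n.+1} :=
  [multinom oapp m 0%N (unlift j i) | i < n.+1].

Lemma mnm_ins0_eq n (j : 'I_n.+1) (m : 'X_{1..n}) (m' : 'X_{1..n.+1}) :
  (mnm_ins0 n j m == m') = (m' j == 0%N) && (m == mnm_del n j m').
Proof.
apply/eqP/andP => [<-|[/eqP m'j0 /eqP ->]].
  split; first by rewrite mnmE unlift_none.
  by apply/eqP/mnmP => i; rewrite !mnmE liftK.
by apply/mnmP => i; rewrite mnmE; case: unliftP => [k ->|->]; rewrite /= ?mnmE.
Qed.

(** The indices of [m] are, up to order, [j] followed by the values of [lift j]. *)
Lemma perm_mnm_del n (j : 'I_n.+1) (m : 'X_{1..n.+1}) :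
  perm_eq m (m j :: mnm_del n j m).
Proof.
have mapE k (f : 'I_k -> nat) : [multinom f i | i < k] = map f (enum 'I_k) :> seq nat.
  by [].
have -> : m = map m (enum 'I_n.+1) :> seq nat.
  by rewrite -mapE; congr (val (val _)); apply/mnmP => i; rewrite mnmE.
rewrite /mnm_del mapE [X in _ :: X](map_comp m (lift j)) -map_cons perm_map //.
apply: uniq_perm; first exact: enum_uniq.
  rewrite /= map_inj_uniq ?enum_uniq ?andbT; last exact: lift_inj.
  by apply/mapP => -[i _ /eqP]; rewrite (negbTE (neq_lift _ _)).
move=> i; rewrite mem_enum in_cons; case: (unliftP j i) => [k ->|->]; last by rewrite eqxx.
by rewrite map_f ?orbT ?mem_enum.
Qed.

(** The renaming produces only monomials without the variable [j], and each of these comes from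
    exactly one monomial, given by [mnm_del]. *)
Lemma mcoeff_comp_lift (K : fieldType) n (f : {mpoly K[n]}) (j : 'I_n.+1) m :
  (f \mPo [tuple 'X_(lift j i) | i < n])@_m =
  (m j == 0%N)%:R * f@_(mnm_del n j m).
Proof.
have XE (m' : 'X_{1..n}) : \prod_(i < n) tnth [tuple 'X_(lift j i) : {mpoly K[n.+1]} | i < n] i ^+ m' i
    = 'X_[mnm_ins0 n j m'].
  rewrite [RHS]mpolyXE_id (bigD1_ord j) //= mnmE unlift_none expr0 mul1r.
  by apply: eq_bigr => i _; rewrite tnth_mktuple mnmE liftK.
rewrite comp_mpolyE raddf_sum /= [X in _ * X@__]mpolyE raddf_sum /= mulr_sumr.
apply: eq_bigr => m' _; rewrite XE !mcoeffZ !mcoeffX mnm_ins0_eq mulrCA.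
by rewrite -mulnb natrM.
Qed.

Lemma Q0_monsym (K : fieldType) n (lam : n.-tuple nat) :
  Q0_mpoly (monsym_mpoly K lam) =
  (n.+1%:R^-1 * (count_mem 0%N (rcons lam 0%N))%:R)
    *: monsym_mpoly K (rcons_tuple lam 0%N).
Proof.
apply/mpolyP => m; rewrite !mcoeffZ raddf_sum mcoeff_monsym -mulrA /=.
congr (_ * _).
have zE j : m j == 0%N ->
    perm_eq (mnm_del n j m) lam = perm_eq m (rcons lam 0%N).
  (* The zero at [j] cancels against the zero appended to [lam]. *)
  move=> /eqP mj0; rewrite (permPl (perm_mnm_del n j m)) mj0.
  by rewrite [RHS]perm_sym perm_rcons perm_cons perm_sym.
transitivity (\sum_(j < n.+1) (m j == 0%N)%:R
    * (perm_eq m (rcons lam 0%N))%:R : K).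
  apply: eq_bigr => j _; rewrite mcoeff_comp_lift mcoeff_monsym.
  by case: eqVneq => [/eqP/zE ->|_]; rewrite ?mul0r.
rewrite -mulr_suml; case: (boolP (perm_eq _ _)) => [pm|_]; last by rewrite !mulr0.
(* Since [m] rearranges [(lam, 0)], the admissible [j] are as many as the zeros of [(lam, 0)]. *)
rewrite -(permP pm) -natr_sum; congr (_%:R * _).
by rewrite -sumn_count sumnE big_map big_tuple.
Qed.

(** At the all-ones point, [Q0_mpoly f] averages [n.+1] copies of the same value. *)
Lemma Q0_eval1 (K : fieldType) n (f : {mpoly K[n]}) :
  n.+1%:R != 0 :> K -> (Q0_mpoly f).@[fun=> 1] = f.@[fun=> 1].
Proof.
move=> n1_neq0; rewrite mevalZ raddf_sum /=.
rewrite (eq_bigr (fun=> f.@[fun=> 1])) => [|j _].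
  by rewrite sumr_const card_ord -[X in _ * X]mulr_natl mulKf.
rewrite comp_mpoly_meval; apply: meval_eq => i.
by rewrite !tnth_mktuple mevalXU.
Qed.

Lemma Q0'_nmonsym (K : numFieldType) n (lam : n.-tuple nat) :
  Q0' (nmonsym K lam) = nmonsym K (rcons_tuple lam 0%N).
Proof.
rewrite /nmonsym linearZ /=.
set a : K := n.+1%:R^-1 * (count_mem 0%N (rcons lam 0%N))%:R.
have a_neq0 : a != 0.
  (* The appended zero makes the count a successor. *)
  by rewrite mulf_neq0 ?invr_eq0 ?pnatr_eq0 // -cats1 count_cat addn1.
have Q0E : Q0' (monsym K lam) = a *: monsym K (rcons_tuple lam 0%N).
  by apply: val_inj; rewrite /= Q0_monsym.
have -> : (monsym K lam).@[fun=> 1]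
    = a * (monsym K (rcons_tuple lam 0%N)).@[fun=> 1].
  by rewrite /= -Q0_eval1 ?pnatr_eq0 // Q0_monsym mevalZ.
by rewrite Q0E scalerA invfM mulrAC mulVf // mul1r.
Qed.

(* The complex field is R[i] for a realType R, and n.+1 is the number of
   variables on the target side. *)
Theorem proposition2p3 (R : realType) (n : nat) (hn : (2 <= n.+1)%N)
    (lam : n.-tuple nat) (hlam : sorted geq lam) :
  Q0' (nmonsym R[i] lam) = nmonsym R[i] (rcons_tuple lam 0%N).
Proof. exact: Q0'_nmonsym. Qed.
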